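(* Let $r\geq 4$ be an integer and let $M$ be a matroid of rank $r$, on a finite or infinite ground set, that has a line $\ell$ and a hyperplane $H$ with $\ell\cap H=\emptyset$. Then $M$ has a loopless extension $N$ such that $\mathrm{cl}_{N'}(\ell)\cap \mathrm{cl}_{N'}(H)=\emptyset$ for every loopless extension $N'$ of $N$. Consequently, if $M$ also has the intersection property, then $M$ is not sticky.
   Context: Matroids may have finite or infinite ground sets; all matroids considered have finite rank. $E(M)$ denotes the ground set of $M$, $r_M$ its rank function, and $\mathrm{cl}_M$ its closure operator. A line is a flat of rank $2$; a hyperplane of a rank-$r$ matroid is a flat of rank $r-1$. An extension of $M$ is a matroid $N$ with $E(M)\subseteq E(N)$ whose restriction to $E(M)$ is $M$ (the rank of $N$ may exceed that of $M$). A matroid is loopless if it has no loops. A pair $(X,Y)$ of flats of $M$ is modular if $r_M(X)+r_M(Y)=r_M(X\cup Y)+r_M(X\cap Y)$, and non-modular otherwise. A modular cut of $M$ is a collection $\mathcal{M}$ of flats of $M$ such that (i) every flat of $M$ containing a member of $\mathcal{M}$ is in $\mathcal{M}$, and (ii) if $X,Y\in\mathcal{M}$ and $(X,Y)$ is a modular pair, then $X\cap Y\in\mathcal{M}$. $M$ has the intersection property if, whenever $(X,Y)$ is a non-modular pair of flats of $M$, there is a modular cut of $M$ that includes $X$ and $Y$ as members but not $X\cap Y$. Given matroids $N_1$ and $N_2$ whose restrictions to $E(N_1)\cap E(N_2)$ are equal, an amalgam of $N_1$ and $N_2$ is a matroid on $E(N_1)\cup E(N_2)$ having both $N_1$ and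 $N_2$ as restrictions. A matroid $M$ is sticky if, whenever $N_1$ and $N_2$ are matroids whose restrictions to $E(N_1)\cap E(N_2)$ are equal to each other and isomorphic to $M$, the matroids $N_1$ and $N_2$ have an amalgam. *)

(* Defs.v *)
From mathcomp Require Import all_boot.
From mathcomp Require Import boolp classical_sets functions cardinality.

Set Implicit Arguments.
Unset Strict Implicit.
Unset Printing Implicit Defensive.

Local Open Scope classical_set_scope.
Local Open Scope card_scope.

(* Matroids of finite rank whose ground set is a finite or infinite subset of
   T.  [indep_bounded] is the finite-rank condition; it makes all independent
   sets finite, so [indep_aug] covers all pairs of independent sets. *)
Record matroid (T : Type) : Type := Matroid {
  ground : set T;
  indep : set (set T);
  indep_ground : forall I, indep I -> I `<=` ground;
  indep0 : indep set0;
  indep_sub : forall I J, indep J -> I `<=` J -> indep I;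
  indep_aug : forall I J m n, indep I -> indep J ->
    I #= `I_m -> J #= `I_n -> m < n ->
    exists e, [/\ J e, ~ I e & indep (I `|` [set e])];
  indep_bounded : exists n, forall I, indep I -> I #<= `I_n
}.

Lemma matroid_eqP (T : Type) (M N : matroid T) :
  ground M = ground N -> indep M = indep N -> M = N.
Proof.
case: M N => [E I a b c d e] [E' I' a' b' c' d' e'] /= EE II; subst E' I'.
by congr Matroid; exact: Prop_irrelevance.
Qed.

(* The largest size of an independent subset of X; the default value 0 of
   [xget] is never used, see [rankP]. *)
Definition is_rank (T : Type) (M : matroid T) (X : set T) : set nat :=
  [set n | (exists I, [/\ indep M I, I `<=` X & I #= `I_n]) /\
           (forall I m, indep M I -> I `<=` X -> I #= `I_m -> m <= n)].

Definition rank (T : Type) (M : matroid T) (X : set T) : nat :=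
  xget 0 (is_rank M X).

Lemma rankP (T : Type) (M : matroid T) (X : set T) : is_rank M X (rank M X).
Proof.
apply: xgetPex; have [b bP] := indep_bounded M.
pose P n := `[< exists I, [/\ indep M I, I `<=` X & I #= `I_n] >].
have exP : exists n, P n.
  by exists 0; apply/asboolP; exists set0; split;
    [exact: indep0 | exact: sub0set | rewrite II0].
have ubP n : P n -> n <= b.
  move=> /asboolP[I [/bP Ib _ In]]; rewrite -card_le_II.
  by apply: card_le_trans Ib; move: In; rewrite card_eq_le => /andP[].
case: (ex_maxnP exP ubP) => n /asboolP Pn maxn; exists n; split=> // I m IM IX Im.
by apply: maxn; apply/asboolP; exists I.
Qed.

Definition mrank (T : Type) (M : matroid T) : nat := rank M (ground M).

Definition cl (T : Type) (M : matroid T) (X : set T) : set T :=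
  [set e | ground M e /\ rank M (X `|` [set e]) = rank M X].

Definition flat (T : Type) (M : matroid T) (F : set T) : Prop :=
  F `<=` ground M /\ cl M F = F.

Definition line (T : Type) (M : matroid T) (L : set T) : Prop :=
  flat M L /\ rank M L = 2.

Definition hyperplane (T : Type) (M : matroid T) (H : set T) : Prop :=
  flat M H /\ (rank M H).+1 = mrank M.

Definition loop (T : Type) (M : matroid T) (e : T) : Prop :=
  ground M e /\ ~ indep M [set e].

Definition loopless (T : Type) (M : matroid T) : Prop :=
  forall e, ~ loop M e.

Section Restriction.
Variables (T : Type) (M : matroid T) (X : set T).

Let rindep : set (set T) := [set I | indep M I /\ I `<=` X].

Let rindep_ground I : rindep I -> I `<=` ground M `&` X.
Proof. by move=> [/indep_ground IM IX] e Ie; split; [exact: IM | exact: IX]. Qed.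

Let rindep0 : rindep set0.
Proof. by split; [exact: indep0 | exact: sub0set]. Qed.

Let rindep_sub I J : rindep J -> I `<=` J -> rindep I.
Proof.
move=> [JM JX] IJ; split; first exact: indep_sub JM IJ.
exact: subset_trans IJ JX.
Qed.

Let rindep_aug I J m n : rindep I -> rindep J ->
  I #= `I_m -> J #= `I_n -> m < n ->
  exists e, [/\ J e, ~ I e & rindep (I `|` [set e])].
Proof.
move=> [IM IX] [JM JX] Im Jn mn.
have [e [Je nIe IeM]] := indep_aug IM JM Im Jn mn.
by exists e; split=> //; split=> // x [/IX//|->]; exact: JX.
Qed.

Let rindep_bounded : exists n, forall I, rindep I -> I #<= `I_n.
Proof. by have [n nP] := indep_bounded M; exists n => I [/nP]. Qed.

Definition restrict : matroid T :=
  Matroid rindep_ground rindep0 rindep_sub rindep_aug rindep_bounded.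

End Restriction.

Definition isomorphism (T U : Type) (f : T -> U) (M : matroid T)
    (N : matroid U) : Prop :=
  set_bij (ground M) (ground N) f /\
  forall I, I `<=` ground M -> (indep M I <-> indep N (f @` I)).

Definition isomorphic (T U : Type) (M : matroid T) (N : matroid U) : Prop :=
  exists f : T -> U, isomorphism f M N.

(* N is an extension of M, the ground set of M being identified with its image
   under i.  The carrier type is allowed to change because T need not contain
   any element outside the ground set of M. *)
Definition extension (T U : Type) (i : T -> U) (M : matroid T)
    (N : matroid U) : Prop :=
  i @` ground M `<=` ground N /\
  isomorphism i M (restrict N (i @` ground M)).

Definition modular_pair (T : Type) (M : matroid T) (X Y : set T) : Prop :=
  rank M X + rank M Y = rank M (X `|` Y) + rank M (X `&` Y).

Definition modular_cut (T : Type) (M : matroid T) (C : set (set T)) : Prop :=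
  [/\ C `<=` flat M,
      forall X F, C X -> flat M F -> X `<=` F -> C F
    & forall X Y, C X -> C Y -> modular_pair M X Y -> C (X `&` Y)].

Definition intersection_property (T : Type) (M : matroid T) : Prop :=
  forall X Y, flat M X -> flat M Y -> ~ modular_pair M X Y ->
  exists C, [/\ modular_cut M C, C X, C Y & ~ C (X `&` Y)].

Definition amalgam (T : Type) (N1 N2 A : matroid T) : Prop :=
  [/\ ground A = ground N1 `|` ground N2,
      restrict A (ground N1) = N1
    & restrict A (ground N2) = N2].

Definition sticky (T : Type) (M : matroid T) : Prop :=
  forall (U : Type) (N1 N2 : matroid U),
  let E12 := ground N1 `&` ground N2 in
  restrict N1 E12 = restrict N2 E12 ->
  isomorphic M (restrict N1 E12) ->
  exists A : matroid U, amalgam N1 N2 A.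

(* Main.v *)
Require Import Defs.
From mathcomp Require Import all_boot.
From mathcomp Require Import finmap zify.
From mathcomp Require Import boolp classical_sets functions cardinality.

(* If p is a non-loop of a loopless extension of M in the closures of l and H,
   the flats of M whose closures contain p form a modular cut containing l and H
   but not the empty flat. If there is no such cut, N = M works. Otherwise the
   cut yields a virtual point p on l and H, and N is a higher-rank relative of
   the Vamos matroid: attach circuits A + p and B + p with #|A| = #|B| = r,
   truncate to rank 2r, delete p and relax the circuit-hyperplane A + B. In
   every extension of N a point of cl(l) and cl(H) must lie in cl(A) and cl(B),
   so if it is not a loop, A + B has rank at most 2r - 1, whereas it is a basis.
   The intersection property provides the cut, and taking A = {p} instead, one
   gets an extension of M in which l and H do meet; it has no amalgam with N. *)

Set Implicit Arguments.
Unset Strict Implicit.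
Unset Printing Implicit Defensive.

Local Open Scope classical_set_scope.
Local Open Scope card_scope.

(** * Cardinalities of finite sets as natural numbers *)

Section Size.
Variable T : Type.
Implicit Types A B : set T.

(** [{classic T}] equips an arbitrary type with choice. Infinite sets get the default value 0, so
    finiteness has to be carried separately. *)
Definition size_set A : nat := #|` @fset_set {classic T} A|.

Lemma size_set_eq A n : A #= `I_n -> finite_set A /\ size_set A = n.
Proof.
move=> An; split; first by apply/finite_setP; exists n.
exact: (@card_fset_set {classic T}).
Qed.

Lemma card_eq_size_set A : finite_set A -> A #= `I_(size_set A).
Proof. by move=> /finite_setP[n An]; have [_ ->] := size_set_eq An. Qed.

Lemma size_set0 : size_set set0 = 0.
Proof. by rewrite /size_set (@fset_set0 {classic T}) cardfs0. Qed.

Lemma size_set1 x : size_set [set x] = 1.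
Proof. by rewrite /size_set (@fset_set1 {classic T}) cardfs1. Qed.

Lemma size_setUI A B : finite_set A -> finite_set B ->
  size_set (A `|` B) + size_set (A `&` B) = size_set A + size_set B.
Proof.
move=> fA fB; rewrite /size_set (@fset_setU {classic T})//.
by rewrite (@fset_setI {classic T})// cardfsUI.
Qed.

Lemma size_setU A B : finite_set A -> finite_set B -> A `&` B = set0 ->
  size_set (A `|` B) = size_set A + size_set B.
Proof. by move=> fA fB AB0; rewrite -size_setUI// AB0 size_set0 addn0. Qed.

Lemma size_setU1 A x : finite_set A -> ~ A x ->
  size_set (A `|` [set x]) = (size_set A).+1.
Proof.
move=> fA Ax; rewrite size_setU ?size_set1 ?addn1//.
by rewrite -subset0 => y [Ay /= yx]; apply: Ax; rewrite -yx.
Qed.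

Lemma size_setD A B : finite_set B -> A `<=` B ->
  size_set B = size_set A + size_set (B `\` A).
Proof.
move=> fB AB; rewrite -size_setU ?setDE ?setIA; last 3 first.
- exact: sub_finite_set fB.
- by apply: finite_setIl.
- by rewrite -subset0 => y [[Ay _] /(_ Ay)].
congr size_set; apply/seteqP; split=> [y By|y [/AB//|[]//]].
by have [Ay|Ay] := pselect (A y); [left|right].
Qed.

End Size.

Lemma size_set_image (T U : Type) (f : T -> U) (A : set T) :
  (forall x y, A x -> A y -> f x = f y -> x = y) ->
  finite_set A -> size_set (f @` A) = size_set A.
Proof.
move=> finj fA; suff /size_set_eq[] : f @` A #= `I_(size_set A) by [].
apply: card_eq_trans (card_eq_size_set fA).
by apply: inj_card_eq => x y; rewrite !inE; exact: finj.
Qed.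

Lemma finite_preim_image (T U : Type) (f : T -> U) (A : set T) :
  (forall x y, A x -> A y -> f x = f y -> x = y) ->
  finite_set (f @` A) -> finite_set A.
Proof.
move=> finj; apply: card_le_finite.
rewrite (card_le_eqr (inj_card_eq _))// => x y; rewrite !inE; exact: finj.
Qed.

Lemma finite_set_size_ind (T : Type) (P : set T -> Prop) : P set0 ->
  (forall X x, finite_set X -> ~ X x -> P X -> P (X `|` [set x])) ->
  forall X, finite_set X -> P X.
Proof.
move=> P0 PU X fX; move: {2}(size_set X) (erefl (size_set X)) => n.
elim: n X fX => [|n IHn] X fX nX.
  move/eqP: nX; rewrite cardfs_eq0 => /eqP /(@fset_set_set0 {classic T}) -> //.
have [x Xx] : exists x, X x.
  apply: contrapT => /forallNP Xe.
  have X0 : X = set0 by rewrite -subset0.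
  by move: nX; rewrite X0 size_set0.
have eX : X = (X `\` [set x]) `|` [set x].
  apply/seteqP; split=> y; last by case=> [[]//|->].
  by have [->|yx] := pselect (y = x); [right|left].
have sx : [set x] `<=` X by move=> _ ->.
have := size_setD fX sx; rewrite size_set1 nX => -[sX].
have fD := @finite_setD _ X [set x] fX.
by rewrite eX; apply: PU => //; [by case=> _; apply|exact: IHn (esym sX)].
Qed.

(** * Rank, submodularity and closure *)

Section Rank.
Variables (T : Type) (M : matroid T).
Implicit Types I J X Y F : set T.

Lemma indep_finite I : indep M I -> finite_set I.
Proof.
have [n nP] := indep_bounded M => /nP In.
exact: card_le_finite In (finite_II n).
Qed.

Lemma indep_augment I J : indep M I -> indep M J -> size_set I < size_set J ->
  exists e, [/\ J e, ~ I e & indep M (I `|` [set e])].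
Proof.
move=> MI MJ; have cI := card_eq_size_set (indep_finite MI).
exact: indep_aug MI MJ cI (card_eq_size_set (indep_finite MJ)).
Qed.

Lemma size_le_rank I X : indep M I -> I `<=` X -> size_set I <= rank M X.
Proof.
move=> MI IX; apply: (rankP M X).2 (MI) IX _.
exact: card_eq_size_set (indep_finite MI).
Qed.

Lemma rank_basis X : exists I, [/\ indep M I, I `<=` X & size_set I = rank M X].
Proof.
have [[I [MI IX In]] _] := rankP M X; exists I; split=> //.
by have [] := size_set_eq In.
Qed.

Lemma basis_extend I X : indep M I -> I `<=` X ->
  exists J, [/\ indep M J, I `<=` J, J `<=` X & size_set J = rank M X].
Proof.
move: {2}(rank M X - size_set I) (leqnn (rank M X - size_set I)) => k.
elim: k I => [|k IHk] I hk MI IX.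
  by exists I; split=> //; have := size_le_rank MI IX; lia.
have [e|ne] := eqVneq (size_set I) (rank M X).
  by exists I; split=> //; exact: subset_refl.
have lt : size_set I < rank M X by rewrite ltn_neqAle ne size_le_rank.
have [B [MB BX Bs]] := rank_basis X; rewrite -Bs in lt.
have [e [Be Ie MIe]] := indep_augment MI MB lt.
have [||J [MJ IJ JX Js]] := IHk _ _ MIe.
- rewrite size_setU1//; [|exact: indep_finite]; lia.
- by move=> x [/IX//|->]; exact: BX.
by exists J; split=> //; apply: subset_trans IJ; exact: subsetUl.
Qed.

Lemma rank_le_size X : finite_set X -> rank M X <= size_set X.
Proof.
move=> fX; have [I [_ IX <-]] := rank_basis X.
by rewrite (size_setD fX IX) leq_addr.
Qed.

Lemma rank_mono X Y : X `<=` Y -> rank M X <= rank M Y.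
Proof.
move=> XY; have [I [MI IX <-]] := rank_basis X.
exact: size_le_rank MI (subset_trans IX XY).
Qed.

Lemma rank_ground X : rank M (X `&` ground M) = rank M X.
Proof.
apply/eqP; rewrite eqn_leq rank_mono//=.
have [I [MI IX <-]] := rank_basis X; apply: size_le_rank => // x Ix.
by split; [exact: IX|exact: indep_ground MI _ Ix].
Qed.

Lemma rank_indep I : indep M I -> rank M I = size_set I.
Proof.
move=> MI; apply/eqP; rewrite eqn_leq size_le_rank// rank_le_size//.
exact: indep_finite.
Qed.

Lemma indep_rank I : finite_set I -> rank M I = size_set I -> indep M I.
Proof.
move=> fI; have [J [MJ JI <-]] := rank_basis I; rewrite (size_setD fI JI) => e.
have /eqP : size_set (I `\` J) = 0 by lia.
rewrite cardfs_eq0 => /eqP /(@fset_set_set0 {classic T}) IJ.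
suff <- : J = I by [].
apply/seteqP; split=> // x Ix; apply: contrapT => Jx.
by have : (I `\` J) x by []; rewrite IJ//; exact: finite_setD.
Qed.

Lemma rank_set0 : rank M set0 = 0.
Proof. by rewrite rank_indep ?size_set0//; exact: indep0. Qed.

Lemma rank_set1_le x : rank M [set x] <= 1.
Proof. by rewrite -(size_set1 x); apply: rank_le_size; exact: finite_set1. Qed.

(** A basis [I] of the intersection extends to a basis [J] of [X], then to a basis [K] of the union.
    By maximality of [J], elements of [K] in [X] lie in [J], so [I] together with [K] minus [J] is
    an independent subset of [Y]. *)
Lemma rank_submod X Y :
  rank M (X `|` Y) + rank M (X `&` Y) <= rank M X + rank M Y.
Proof.
have [I [MI IXY Is]] := rank_basis (X `&` Y).
have [J [MJ IJ JX Js]] := basis_extend MI (subset_trans IXY (@subIsetl _ X Y)).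
have [K [MK JK KXY Ks]] := basis_extend MJ (subset_trans JX (@subsetUl _ X Y)).
have fK := indep_finite MK.
rewrite -Is -Js -Ks (size_setD fK JK) -addnA leq_add2l.
have KJX x : X x -> K x -> J x.
  move=> Xx Kx; apply: contrapT => Jx.
  have : indep M (J `|` [set x]).
    by apply: indep_sub MK _ => y [/JK//|->].
  have JxX : J `|` [set x] `<=` X by move=> y [/JX|->].
  move=> /size_le_rank /(_ JxX).
  by rewrite size_setU1 ?Js ?ltnn//; exact: indep_finite.
rewrite addnC -size_setU; first last.
- by rewrite -subset0 => x [/IJ Jx [_]].
- exact: finite_setD.
- exact: indep_finite.
apply: size_le_rank.
  by apply: indep_sub MK _ => x [/IJ/JK|[]].
move=> x [/IXY[]//|[Kx Jx]]; have [/KJX Xx|//] := KXY x Kx.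
by case: Jx; exact: Xx.
Qed.

Lemma rankU1_mem X x : X x -> rank M (X `|` [set x]) = rank M X.
Proof. by move=> Xx; rewrite setUidl// => _ ->. Qed.

(** [Y] may be infinite, so there is no induction on it: if the rank grew, a basis of [X] could be
    augmented by a single element of the union, against the hypothesis on that element. *)
Lemma rank_spanned X Y : (forall y, Y y -> rank M (X `|` [set y]) = rank M X) ->
  rank M (X `|` Y) = rank M X.
Proof.
move=> Yspan; apply/eqP; rewrite eqn_leq [X in _ && X]rank_mono ?andbT;
  last exact: subsetUl.
have [I [MI IX Is]] := rank_basis X; rewrite leqNgt; apply/negP => lt.
have [J [MJ JXY Js]] := rank_basis (X `|` Y).
rewrite -Is -Js in lt; have [e [Je Ie MIe]] := indep_augment MI MJ lt.
have : rank M (X `|` [set e]) = rank M X.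
  by have [/rankU1_mem|/Yspan] := JXY e Je.
have : I `|` [set e] `<=` X `|` [set e] by move=> y [/IX|->]; [left|right].
move=> /(size_le_rank MIe); rewrite size_setU1 ?Is//; last exact: indep_finite.
by move=> /[swap] ->; rewrite ltnn.
Qed.

(** Submodularity for [Y] and the union of [X] and [Z]: their intersection contains [X], which
    already has the rank of [Y]. *)
Lemma rank_sandwich X Y Z : rank M Y <= rank M X -> X `<=` Y ->
  rank M (Y `|` Z) = rank M (X `|` Z).
Proof.
move=> YX XY; apply/eqP; rewrite eqn_leq; apply/andP; split; last first.
  by apply: rank_mono => x [/XY|]; [left|right].
have -> : Y `|` Z = Y `|` (X `|` Z).
  by apply/seteqP; split=> x [|]; [left|right; right|left|case=> [/XY|]; [left|right]].
have := rank_submod Y (X `|` Z).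
have : rank M X <= rank M (Y `&` (X `|` Z)).
  by apply: rank_mono => x Xx; split; [exact: XY|left].
lia.
Qed.

Lemma mem_cl X x : ground M x -> rank M (X `|` [set x]) <= rank M X -> cl M X x.
Proof.
by move=> Mx le; split=> //; apply/eqP; rewrite eqn_leq le rank_mono.
Qed.

Lemma sub_cl X : X `<=` ground M -> X `<=` cl M X.
Proof.
by move=> XM x Xx; split; [exact: XM|exact: rankU1_mem].
Qed.

Lemma rank_Ucl X Y : Y `<=` cl M X -> rank M (X `|` Y) = rank M X.
Proof. by move=> Yc; apply: rank_spanned => y /Yc[]. Qed.

Lemma rank_cl X : rank M (cl M X) = rank M X.
Proof.
apply/eqP; rewrite eqn_leq; apply/andP; split.
  by rewrite -[leqRHS](rank_Ucl (@subset_refl _ (cl M X))) rank_mono//; exact: subsetUr.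
rewrite -rank_ground rank_mono// => x [Xx Mx]; split=> //.
exact: rankU1_mem.
Qed.

Lemma rankU1_cl X Y x : cl M X x -> X `<=` Y -> rank M (Y `|` [set x]) = rank M Y.
Proof.
move=> [_ Xx] XY; have e := rank_sandwich (X := X) (Y := X `|` [set x]) Y.
have -> : Y `|` [set x] = X `|` [set x] `|` Y.
  by apply/seteqP; split=> y [Yy|Yy];
    [right|left; right|case: Yy => [/XY|]; [left|right]|left].
rewrite e ?Xx//.
by congr rank; apply/seteqP; split=> [y [/XY|]//|y]; right.
Qed.

Lemma cl_mono X Y : X `<=` Y -> cl M X `<=` cl M Y.
Proof. by move=> XY x Xx; split; [case: Xx|exact: rankU1_cl Xx XY]. Qed.

Lemma cl_sub X Y : X `<=` Y -> rank M Y <= rank M X -> cl M Y `<=` cl M X.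
Proof.
move=> XY YX x [Mx Yx]; apply: mem_cl => //.
by apply: leq_trans YX; rewrite -Yx rank_mono// => y [/XY|]; [left|right].
Qed.

Lemma cl_flat X : flat M (cl M X).
Proof.
have clg Y : cl M Y `<=` ground M by move=> y [].
split=> //; apply/seteqP; split; last exact/sub_cl/clg.
move=> x [Mx ex]; apply: mem_cl => //.
rewrite -[leqRHS]rank_cl -ex -[leqLHS]rank_ground rank_mono// => y [[Xy|->] My].
- by left; split=> //; exact: rankU1_mem.
- by right.
Qed.

Lemma flatI X Y : flat M X -> flat M Y -> flat M (X `&` Y).
Proof.
move=> [XM clX] [YM clY]; split=> [x [/XM]//|].
apply/seteqP; split; last by apply: sub_cl => x [/XM].
by move=> x cx; split; [rewrite -clX|rewrite -clY]; apply: cl_mono cx => y [].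
Qed.

Lemma loopless_rank x : loopless M -> ground M x -> rank M [set x] = 1.
Proof.
move=> Ml Mx; rewrite rank_indep ?size_set1//.
by apply: contrapT => nx; apply: (Ml x).
Qed.

End Rank.

Lemma extension_rank (T U : Type) (i : T -> U) (M : matroid T) (N : matroid U)
    (X : set T) :
  extension i M N -> X `<=` ground M -> rank N (i @` X) = rank M X.
Proof.
move=> [_ [[_ iinj _] iI]] XM.
have inj Y : Y `<=` X -> forall x y, Y x -> Y y -> i x = i y -> x = y.
  by move=> YX x y Yx Yy; apply: iinj; rewrite inE; apply/XM/YX.
apply/eqP; rewrite eqn_leq; apply/andP; split.
  have [J [NJ JX <-]] := rank_basis N (i @` X).
  have [Y [YX EJ]] : exists Y, Y `<=` X /\ J = i @` Y.
    exists (X `&` i @^-1` J); split; first exact: subIsetl.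
    apply/seteqP; split=> [y Jy|y [x [Xx Jx] <-]//].
    by have [x Xx ey] := JX y Jy; exists x => //; split=> //=; rewrite ey.
  have fY : finite_set Y.
    by apply: (finite_preim_image (inj Y YX)); rewrite -EJ; exact: indep_finite NJ.
  rewrite EJ size_set_image//; last exact: inj.
  apply: size_le_rank => //; apply/iI; first exact: subset_trans XM.
  by rewrite -EJ; split=> // y /JX; apply: image_subset.
have [I [MI IX <-]] := rank_basis M X.
rewrite -(size_set_image (inj _ IX)); last exact: indep_finite MI.
apply: size_le_rank; last exact: image_subset.
by have [] := (iI I (subset_trans IX XM)).1 MI.
Qed.

(** * The matroid of a bounded submodular function *)

Section MatroidOfRank.
Variables (T : Type) (E : set T) (rho : set T -> nat) (b : nat).
Hypothesis rho0 : rho set0 = 0.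
Hypothesis rho1 : forall x, rho [set x] <= 1.
Hypothesis rho_mono : forall X Y, X `<=` Y -> rho X <= rho Y.
Hypothesis rho_submod : forall X Y,
  rho (X `|` Y) + rho (X `&` Y) <= rho X + rho Y.
Hypothesis rho_bounded : forall X, rho X <= b.

Lemma rhoU_le X Y : rho (X `|` Y) <= rho X + rho Y.
Proof. by have := rho_submod X Y; lia. Qed.

Lemma rho_le_size X : finite_set X -> rho X <= size_set X.
Proof.
move: X; apply: finite_set_size_ind => [|X x fX Xx IH]; first by rewrite rho0.
by rewrite size_setU1//; have := rhoU_le X [set x]; have := rho1 x; lia.
Qed.

(** Induction on [Y]: the sets [X] + [Y] and [X] + [y] both have value at most [rho X] and meet in a
    superset of [X], so submodularity bounds their union. *)
Lemma rho_spanned X Y : finite_set Y ->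
  (forall y, Y y -> rho (X `|` [set y]) <= rho X) -> rho (X `|` Y) <= rho X.
Proof.
move: Y; apply: finite_set_size_ind => [|Y y fY Yy IH] h; first by rewrite setU0.
have {}IH : rho (X `|` Y) <= rho X by apply: IH => z Yz; apply: h; left.
have hy : rho (X `|` [set y]) <= rho X by apply: h; right.
have -> : X `|` (Y `|` [set y]) = (X `|` Y) `|` (X `|` [set y]).
  by rewrite setUACA setUid.
have := rho_submod (X `|` Y) (X `|` [set y]).
have : rho X <= rho ((X `|` Y) `&` (X `|` [set y])).
  by apply: rho_mono => x Xx; split; left.
lia.
Qed.

(** As [rho] never exceeds the size of a finite set, the inequality amounts to equality. Finiteness
    is demanded because [size_set] is 0 on infinite sets. *)
Let rindep : set (set T) :=
  [set I | [/\ I `<=` E, finite_set I & size_set I <= rho I]].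

Let rindep_ground I : rindep I -> I `<=` E. Proof. by case. Qed.

Let rindep0 : rindep set0.
Proof. by split; [exact: sub0set|exact: finite_set0|rewrite size_set0]. Qed.

Let rindep_sub I J : rindep J -> I `<=` J -> rindep I.
Proof.
move=> [JE fJ Js] IJ; split; [exact: subset_trans JE|exact: sub_finite_set fJ|].
have := rhoU_le I (J `\` I); rewrite setDE setUIr setUv setIT.
have -> : I `|` J = J by apply/seteqP; split=> x; [case=> // /IJ|right].
have := rho_le_size (@finite_setD _ J I fJ); have := size_setD fJ IJ.
rewrite -setDE; lia.
Qed.

Let rindep_aug I J m n : rindep I -> rindep J ->
  I #= `I_m -> J #= `I_n -> m < n ->
  exists e, [/\ J e, ~ I e & rindep (I `|` [set e])].
Proof.
move=> [IE fI Is] [JE fJ Js] /size_set_eq[_ <-] /size_set_eq[_ <-] lt.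
apply: contrapT => /forallNP ne.
(* If no element of [J] augments [I], then [I] spans all of [J], which is impossible by size. *)
suff : rho (I `|` J) <= rho I.
  have : rho J <= rho (I `|` J) by apply: rho_mono => ? ?; right.
  by have := rho_le_size fI; lia.
apply: rho_spanned => // y Jy.
have [Iy|Iy] := pselect (I y).
  by apply: rho_mono => x [//|->].
rewrite leqNgt; apply/negP => lty; apply: (ne y); split=> //.
split; [by move=> x [/IE//|->]; exact: JE| |by rewrite size_setU1//; lia].
by rewrite finite_setU; split=> //; exact: finite_set1.
Qed.

Let rindep_bounded : exists n, forall I, rindep I -> I #<= `I_n.
Proof.
exists b => I [_ fI Is].
rewrite (card_le_eql (card_eq_size_set fI)) card_le_II.
exact: leq_trans (rho_bounded I).
Qed.

Definition matroid_of_rank : matroid T :=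
  Matroid rindep_ground rindep0 rindep_sub rindep_aug rindep_bounded.

Lemma rank_of_rank_le X : rank matroid_of_rank X <= rho X.
Proof.
have [I [[_ _ Is] IX <-]] := rank_basis matroid_of_rank X.
exact: leq_trans (rho_mono IX).
Qed.

(** Finiteness matters: the hypotheses do not force the value of [rho] on an infinite set to be
    attained on a finite subset, so there only the upper bound survives. *)
Lemma rank_of_rank X : finite_set X -> X `<=` E ->
  rank matroid_of_rank X = rho X.
Proof.
move=> fX XE; apply/eqP; rewrite eqn_leq rank_of_rank_le/=.
have [I [MI IX e]] := rank_basis matroid_of_rank X; have [_ fI Is] := MI.
suff : rho (I `|` X) <= rho I.
  have : rho X <= rho (I `|` X) by apply: rho_mono => ? ?; right.
  by have := rho_le_size fI; lia.
apply: rho_spanned => // y Xy.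
have [Iy|Iy] := pselect (I y); first by apply: rho_mono => x [//|->].
rewrite leqNgt; apply/negP => lty.
have IyX : I `|` [set y] `<=` X by move=> x [/IX|->].
have : indep matroid_of_rank (I `|` [set y]).
  split; [exact: subset_trans XE| |by rewrite size_setU1//; lia].
  by rewrite finite_setU; split=> //; exact: finite_set1.
by move=> /size_le_rank /(_ IyX); rewrite size_setU1// e ltnn.
Qed.

End MatroidOfRank.

(** * Looplessness from two disjoint flats *)

Section DisjointFlats.
Variables (T : Type) (M : matroid T) (l H : set T).
Hypotheses (fl : flat M l) (fH : flat M H) (lH0 : l `&` H = set0).

(** Every element of the closure is a loop, hence lies in every flat, in particular in both [l] and
    [H]. *)
Lemma rank0_cl X : rank M X = 0 -> cl M X = set0.
Proof.
move=> X0; rewrite -subset0 -lH0 => x clx.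
have c0 : cl M set0 x.
  split; [by case: clx|rewrite rank_set0 set0U; apply/eqP].
  by rewrite -leqn0 -X0 -(rank_cl M X); apply: rank_mono => _ ->.
have sub F : flat M F -> F x.
  by move=> [_ <-]; apply: cl_mono c0; exact: sub0set.
by split; exact: sub.
Qed.

Lemma disjoint_flats_loopless : loopless M.
Proof.
move=> x [Mx nx].
have : rank M [set x] = 0.
  have := rank_set1_le M x; case e: (rank M [set x]) => [|[|]]// _; case: nx.
  by apply: indep_rank; rewrite ?size_set1//; exact: finite_set1.
move=> /rank0_cl c0; have : cl M [set x] x by apply: sub_cl => // _ ->.
by rewrite c0.
Qed.

End DisjointFlats.

(** * The one-point extension given by a modular cut *)

Section ProperModularCut.
Variables (T : Type) (M : matroid T) (C : set (set T)) (l H : set T).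
Hypotheses (cutC : modular_cut M C) (Cl : C l) (CH : C H) (C0 : ~ C set0).
Hypothesis lH0 : l `&` H = set0.

Lemma cut_flat F : C F -> flat M F. Proof. by case: cutC => h _ _; exact: h. Qed.

Lemma cut_cl_mono X Y : X `<=` Y -> C (cl M X) -> C (cl M Y).
Proof.
move=> XY CX; have [_ up _] := cutC.
by apply: up CX (cl_flat M Y) _; exact: cl_mono.
Qed.

Let cut_rank0_cl X : rank M X = 0 -> cl M X = set0.
Proof. exact: rank0_cl (cut_flat Cl) (cut_flat CH) lH0 X. Qed.

(** A rank-1 member [G] lies in every member [D]: otherwise they form a modular pair whose
    intersection has rank 0, hence is the empty flat, which is not in the cut. So [G] lies in both
    [l] and [H], which is absurd. *)
Lemma rank1_cut F : rank M F = 1 -> ~ C (cl M F).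
Proof.
move=> F1 CF; set G := cl M F in CF; have fG : flat M G := cl_flat M F.
have G1 : rank M G = 1 by rewrite rank_cl.
have sub D : C D -> G `<=` D.
  move=> CD; have fD := cut_flat CD; have fGD := flatI fG fD.
  apply: contrapT => GD; have GD0 : rank M (G `&` D) = 0.
    apply: contrapT => n0; apply: GD; rewrite -fG.2.
    apply: subset_trans (@cl_sub _ M (G `&` D) _ _ _) _; first exact: subIsetl.
      by rewrite G1; lia.
    by rewrite fGD.2; exact: subIsetr.
  have Dlt : rank M D < rank M (G `|` D).
    rewrite ltnNge; apply/negP => le; apply: GD => x Gx.
    rewrite -fD.2; apply: mem_cl; first exact: fG.1.
    by apply: leq_trans le; apply: rank_mono => y [Dy|->]; [right|left].
  have mGD : modular_pair M G D.
    by rewrite /modular_pair; have := rank_submod M G D; lia.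
  have [_ _ inter] := cutC; have := inter _ _ CF CD mGD.
  by rewrite -fGD.2 cut_rank0_cl.
have : G `<=` set0 by rewrite -lH0 => x Gx; split; exact: sub Gx.
by rewrite subset0 => G0; move: G1; rewrite G0 rank_set0.
Qed.

(* The rank of Y with p added, in the one-point extension of M by p that the
   modular cut C defines. *)
Definition rank_pt (Y : set T) : nat := rank M Y + ~~ `[< C (cl M Y) >].

Lemma rank_pt_cut Y : C (cl M Y) -> rank_pt Y = rank M Y.
Proof. by move=> CY; rewrite /rank_pt; case: asboolP => //; rewrite addn0. Qed.

Lemma rank_pt_mono X Y : X `<=` Y -> rank_pt X <= rank_pt Y.
Proof.
move=> XY; rewrite /rank_pt; have := rank_mono M XY.
case: asboolP => CX; case: asboolP => CY /=; try by lia.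
(* If the ranks are equal, [cl M Y] is contained in [cl M X], so the latter is in the cut as
   well. *)
rewrite leq_eqVlt => /orP[/eqP e|]; last by lia.
case: CX; have [_ up _] := cutC; apply: up CY (cl_flat M X) _.
by apply: cl_sub => //; rewrite e.
Qed.

(** Submodularity in the one-point extension for [X] and [Y] + p: the intersection does not contain
    p. *)
Lemma rank_pt_mixed X Y :
  rank_pt (X `|` Y) + rank M (X `&` Y) <= rank M X + rank_pt Y.
Proof.
rewrite /rank_pt; have := rank_submod M X Y.
case: (asboolP (C (cl M Y))) => CY; case: asboolP => CXY /=; try lia.
by case: CXY; apply: cut_cl_mono CY => ? ?; right.
Qed.

Lemma rank_pt_submod X Y :
  rank_pt (X `|` Y) + rank_pt (X `&` Y) <= rank_pt X + rank_pt Y.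
Proof.
have XU : C (cl M X) -> C (cl M (X `|` Y)) by apply: cut_cl_mono => ? ?; left.
have YU : C (cl M Y) -> C (cl M (X `|` Y)) by apply: cut_cl_mono => ? ?; right.
rewrite /rank_pt; have := rank_submod M X Y.
case: (asboolP (C (cl M X))) => CX; case: (asboolP (C (cl M Y))) => CY;
  case: (asboolP (C (cl M (X `|` Y)))) => CU;
  case: (asboolP (C (cl M (X `&` Y)))) => CI /=; try lia;
  try (by case: CU; auto).
(* In the surviving case the closures of [X] and [Y] are in the cut and that of the intersection is
   not, so a strict inequality is needed. Equality would make the two closures a modular pair
   meeting exactly in the third. *)
rewrite addn1 addn0 addn0 addn0 addnS leq_eqVlt => /orP[/eqP e|]; last by lia.
case: CI; have IX := @subIsetl _ X Y; have IY := @subIsetr _ X Y.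
have IcI : cl M (X `&` Y) `<=` cl M X `&` cl M Y.
  by move=> x cx; split; apply: cl_mono cx.
have rU : rank M (X `|` Y) <= rank M (cl M X `|` cl M Y).
  rewrite -rank_ground; apply: rank_mono => x [[Xx|Yx] Mx]; [left|right].
    by split=> //; exact: rankU1_mem.
  by split=> //; exact: rankU1_mem.
have := rank_submod M (cl M X) (cl M Y); rewrite !rank_cl => rs.
have := rank_mono M IcI; rewrite rank_cl => rI.
have mXY : modular_pair M (cl M X) (cl M Y).
  by rewrite /modular_pair !rank_cl; lia.
have [_ _ inter] := cutC; have := inter _ _ CX CY mXY.
suff <- : cl M (X `&` Y) = cl M X `&` cl M Y by [].
apply/seteqP; split=> //.
rewrite -(flatI (cl_flat M X) (cl_flat M Y)).2 -[X in _ `<=` X](cl_flat M _).2.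
by apply: cl_sub => //; rewrite rank_cl; lia.
Qed.

Lemma rank_le_pt Y : rank M Y <= rank_pt Y. Proof. exact: leq_addr. Qed.

(** The virtual point p is not a loop. *)
Lemma rank_pt_gt0 Y : 0 < rank_pt Y.
Proof.
rewrite /rank_pt; case: asboolP => CY /=; last by lia.
have [/cut_rank0_cl c0|] := eqVneq (rank M Y) 0; last by lia.
by move: CY; rewrite c0.
Qed.

(** The virtual point p is not parallel to an element of [M]. *)
Lemma rank_pt_gt1 Y : 0 < rank M Y -> 1 < rank_pt Y.
Proof.
rewrite leq_eqVlt => /orP[/eqP e|]; last by rewrite /rank_pt; lia.
by rewrite /rank_pt -e; case: asboolP => // /rank1_cut; rewrite -e.
Qed.

End ProperModularCut.

(** * Arithmetic for the submodularity of [vamos_rank] *)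

Lemma trunc_submod a1 a2 au ai A : 0 < A -> au <= A -> ai <= a2 -> ai <= a1 ->
  a2 <= au -> a1 <= au -> au + ai = a1 + a2 ->
  let g a := minn a A.-1 in
  [/\ g au + ai <= a1 + g a2, g au + ai <= g a1 + a2,
      g au + g ai <= g a1 + g a2, g ai <= ai & g ai = ai \/ ai = A].
Proof. by move=> A0 h1 h2 h3 h4 h5 h6 g; rewrite /g; clear g; split; lia. Qed.

(* r, s: rank of the left part without and with p; z, g: size of the right part
   and its truncation; f: vamos_rank. The suffixes u and i stand for the union
   and the intersection of the sets 1 and 2. *)
Lemma vamos_rank_arith R r1 r2 ru ri s1 s2 su si z1 z2 zu zi g1 g2 gu gi
    f1 f2 fu fi :
  (0 < ri -> 1 < si) -> (0 < ru -> 1 < su) ->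
  (0 < r2 -> 1 < s2) -> (0 < r1 -> 1 < s1) ->
  0 < si -> 0 < su -> 0 < s2 -> 0 < s1 ->
  ri <= si -> ru <= su -> r2 <= s2 -> r1 <= s1 ->
  si <= s2 -> si <= s1 -> s2 <= su -> s1 <= su ->
  ri <= r2 -> ri <= r1 -> r2 <= ru -> r1 <= ru ->
  su + ri <= r2 + s1 -> su + ri <= r1 + s2 -> su + si <= s1 + s2 ->
  ru + ri <= r1 + r2 ->
  zu + zi = z1 + z2 ->
  gu + zi <= z1 + g2 -> gu + zi <= g1 + z2 -> gu + gi <= g1 + g2 -> gi <= zi ->
  zi <= gi.+1 \/ (R <= g1.+2 /\ R <= g2.+2) ->
  fi <= f1 -> fi <= f2 ->
  f1 = r1 + z1 \/ f1 = maxn 2 s1 + g1 \/ f1 = R ->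
  f2 = r2 + z2 \/ f2 = maxn 2 s2 + g2 \/ f2 = R ->
  fu <= ru + zu -> fu <= maxn 2 su + gu -> fu <= R ->
  fi <= ri + zi -> fi <= maxn 2 si + gi ->
  fu + fi <= f1 + f2.
Proof.
move=> pi pu p2 p1 *.
have [?|?] : ri = 0 \/ 0 < ri by lia.
  by have [?|?] : r1 = 0 \/ 0 < r1; lia.
lia.
Qed.

(** * The relative of the Vamos matroid built from a cut and two circuits *)

Section Vamos.
Variables (T : Type) (M : matroid T) (C : set (set T)) (l H : set T).
Hypotheses (cutC : modular_cut M C) (Cl : C l) (CH : C H) (C0 : ~ C set0).
Hypothesis lH0 : l `&` H = set0.
Variables (K : finType) (A B : {set K}).
Hypothesis AB0 : A :&: B = finset.set0.
Hypothesis A_gt0 : 0 < #|A|.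
Hypothesis B_gt0 : 0 < #|B|.
Hypothesis rank_le_AB : mrank M <= #|A| + #|B|.

Implicit Types (X : set (T + K)) (Y : set T) (D : {set K}).

Definition left_part X : set T := inl @^-1` X.
Definition right_part X : {set K} := [set k | `[< X (inr k) >]]%SET.

(** Only [A] and [B] are taken from [K], so that two such matroids can share a carrier type and meet
    exactly in [M]. *)
Definition vamos_ground : set (T + K) :=
  [set x | match x with inl t => ground M t | inr k => k \in A :|: B end].

(* The two sums are the ranks without and with p in the closure. Relaxing the
   circuit-hyperplane A :|: B is the maximum with 2, which only matters when the
   left part has rank 0; the outer minimum is the truncation. *)
Definition vamos_rank X : nat :=
  let Y := left_part X in
  let a := #|right_part X :&: A| in let b := #|right_part X :&: B| in
  minn (minn (rank M Y + a + b)
             (maxn 2 (rank_pt M C Y) + minn a #|A|.-1 + minn b #|B|.-1))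
       (#|A| + #|B|).

Lemma right_partP X k : reflect (X (inr k)) (k \in right_part X).
Proof. by rewrite finset.in_set; exact: asboolP. Qed.

Lemma right_partU X X' : right_part (X `|` X') = right_part X :|: right_part X'.
Proof.
apply/setP => k; rewrite finset.in_setU; apply/right_partP/orP.
  by move=> [] /right_partP; [left|right].
by move=> [] /right_partP; [left|right].
Qed.

Lemma right_partI X X' : right_part (X `&` X') = right_part X :&: right_part X'.
Proof.
apply/setP => k; rewrite finset.in_setI.
by apply/right_partP/andP => -[] /right_partP ? /right_partP.
Qed.

Lemma right_partS X X' : X `<=` X' -> right_part X \subset right_part X'.
Proof.
by move=> XX'; apply/fintype.subsetP => k /right_partP /XX' /right_partP.
Qed.

Lemma vamos_rank_mono X X' : X `<=` X' -> vamos_rank X <= vamos_rank X'.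
Proof.
move=> XX'; have YY' : left_part X `<=` left_part X' by move=> t; exact: XX'.
have := rank_mono M YY'; have := rank_pt_mono cutC YY'.
have := subset_leq_card (finset.setSI A (right_partS XX')).
have := subset_leq_card (finset.setSI B (right_partS XX')).
rewrite /vamos_rank /=; lia.
Qed.

Lemma card_setIUI (Z Z' D : {set K}) :
  #|(Z :|: Z') :&: D| + #|Z :&: Z' :&: D| = #|Z :&: D| + #|Z' :&: D|.
Proof. by rewrite finset.setIUl -(cardsUI (Z :&: D)) finset.setIACA finset.setIid. Qed.

Let count (D : {set K}) X := #|right_part X :&: D|.
(** The rank function of the circuit [D] + p after contracting p. *)
Let trunc D X := minn (count D X) #|D|.-1.

Lemma vamos_rank_le X : [/\
    vamos_rank X <= rank M (left_part X) + (count A X + count B X),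
    vamos_rank X <= maxn 2 (rank_pt M C (left_part X)) + (trunc A X + trunc B X)
  & vamos_rank X <= #|A| + #|B|].
Proof. by rewrite /vamos_rank /trunc /count /=; split; lia. Qed.

Lemma vamos_rankE X : vamos_rank X = rank M (left_part X) + (count A X + count B X) \/
  vamos_rank X = maxn 2 (rank_pt M C (left_part X)) + (trunc A X + trunc B X) \/
  vamos_rank X = #|A| + #|B|.
Proof. by rewrite /vamos_rank /trunc /count /=; lia. Qed.

(** The last clause isolates where truncation loses one on the intersection: both sets must then
    contain all of [D]. *)
Let count_trunc X X' (D : {set K}) : 0 < #|D| ->
  [/\ count D (X `|` X') + count D (X `&` X') = count D X + count D X',
      trunc D (X `|` X') + count D (X `&` X') <= count D X + trunc D X' /\
      trunc D (X `|` X') + count D (X `&` X') <= trunc D X + count D X',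
      trunc D (X `|` X') + trunc D (X `&` X') <= trunc D X + trunc D X',
      trunc D (X `&` X') <= count D (X `&` X')
    & count D (X `&` X') <= trunc D (X `&` X') \/
      (count D (X `&` X') = (trunc D (X `&` X')).+1 /\
       #|D| <= (trunc D X).+1 /\ #|D| <= (trunc D X').+1)].
Proof.
move=> D0; have sub X1 X2 : X1 `<=` X2 -> count D X1 <= count D X2.
  by move=> /right_partS ?; apply/subset_leq_card/finset.setSI.
have e : count D (X `|` X') + count D (X `&` X') = count D X + count D X'.
  by rewrite /count right_partU right_partI card_setIUI.
have leD X1 : count D X1 <= #|D| by apply/subset_leq_card/finset.subsetIr.
have := sub _ _ (@subsetUl _ X X'); have := sub _ _ (@subsetUr _ X X').
have := sub _ _ (@subIsetl _ X X'); have := sub _ _ (@subIsetr _ X X').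
move=> h1 h2 h3 h4.
have [k1 k2 k3 k4 k5] := trunc_submod D0 (leD (X `|` X')) h1 h2 h3 h4 e.
split=> //; rewrite /trunc; case: k5 => [->|k5]; [by left|right].
by have := leD X; have := leD X'; lia.
Qed.

(** The values on [X] and [X'] may each come from the branch with p, without p, or from the
    truncation. The maximum with 2 hurts only if the intersection has a left part of rank 0. There
    the branch without p is used instead; it costs at most one more than [trunc] unless the
    intersection contains [A] and [B], and then both sets have full rank. *)
Lemma vamos_rank_submod X X' :
  vamos_rank (X `|` X') + vamos_rank (X `&` X') <= vamos_rank X + vamos_rank X'.
Proof.
set Y := left_part X; set Y' := left_part X'.
have pos2 F := @rank_pt_gt1 _ _ _ _ _ cutC Cl CH C0 lH0 F.
have pos F := rank_pt_gt0 cutC Cl CH C0 lH0 F.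
have [Uz Ug UR] := vamos_rank_le (X `|` X').
have [Iz Ig _] := vamos_rank_le (X `&` X').
have [a1 [a2 a3] a4 a5 a6] := count_trunc X X' A_gt0.
have [b1 [b2 b3] b4 b5 b6] := count_trunc X X' B_gt0.
have mix := rank_pt_mixed cutC Y' Y; rewrite setUC setIC in mix.
apply: (@vamos_rank_arith (#|A| + #|B|) (rank M Y) (rank M Y') _ _
  (rank_pt M C Y) (rank_pt M C Y') _ _
  (count A X + count B X) (count A X' + count B X') _ _
  (trunc A X + trunc B X) (trunc A X' + trunc B X') _ _ _ _ _ _
  (pos2 _) (pos2 _) (pos2 _) (pos2 _)
  (pos _) (pos _) (pos _) (pos _) (rank_le_pt _ _ _) (rank_le_pt _ _ _)
  (rank_le_pt _ _ _) (rank_le_pt _ _ _) _ _ _ _ _ _ _ _ mix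
  (rank_pt_mixed cutC Y Y') (rank_pt_submod cutC Y Y') (rank_submod M Y Y')
  _ _ _ _ _ _ _ _ (vamos_rankE X) (vamos_rankE X') Uz Ug UR Iz Ig).
all: try solve [(apply: (rank_pt_mono cutC) || apply: rank_mono);
  solve [exact: subIsetl|exact: subIsetr|exact: subsetUl|exact: subsetUr]].
all: try by apply: vamos_rank_mono => t [].
all: clear -a1 a2 a3 a4 a5 a6 b1 b2 b3 b4 b5 b6; lia.
Qed.
Lemma vamos_rank0 : vamos_rank set0 = 0.
Proof.
rewrite /vamos_rank /= [left_part set0]preimage_set0 rank_set0.
suff -> : right_part set0 = finset.set0 by rewrite !finset.set0I !cards0; lia.
by apply/setP => k; rewrite finset.in_set0; apply/right_partP.
Qed.

Definition vamos_set (Y : set T) (D : {set K}) : set (T + K) :=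
  inl @` Y `|` inr @` [set` D].

Lemma left_part_vamos_set Y D : left_part (vamos_set Y D) = Y.
Proof.
apply/seteqP; split=> [t [[_ ? [<-]]//|[]//]|t Yt]; by left; exists t.
Qed.

Lemma right_part_vamos_set Y D : right_part (vamos_set Y D) = D.
Proof.
apply/setP => k; apply/right_partP/idP => [[[]//|[_ ? [<-]]//]|Dk].
by right; exists k.
Qed.

Lemma vamos_set0 Y : vamos_set Y finset.set0 = inl @` Y.
Proof.
apply/seteqP; split=> [x [//|[k /=]]|x]; last by left.
by rewrite finset.in_set0.
Qed.

Lemma vamos_set1 Y k : vamos_set Y [set k]%SET = inl @` Y `|` [set inr k].
Proof.
congr (_ `|` _); apply/seteqP; split=> [_ [k' /= + <-]|_ ->].
  by rewrite finset.in_set1 => /eqP ->.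
by exists k => //=; rewrite finset.set11.
Qed.

Lemma vamos_rank_left Y : vamos_rank (inl @` Y) = rank M Y.
Proof.
rewrite -vamos_set0 /vamos_rank /= left_part_vamos_set right_part_vamos_set.
rewrite !finset.set0I !cards0 !min0n !addn0.
have : rank M Y <= mrank M by rewrite -rank_ground rank_mono//; exact: subIsetr.
by have := rank_le_pt M C Y; lia.
Qed.

Lemma vamos_rank_part Y (D : {set K}) : D = A \/ D = B ->
  vamos_rank (vamos_set Y D) =
  minn (minn (rank M Y + #|D|) (maxn 2 (rank_pt M C Y) + #|D|.-1)) (#|A| + #|B|).
Proof.
rewrite /vamos_rank /= left_part_vamos_set right_part_vamos_set.
by case=> ->; rewrite ?AB0 1?[B :&: A]finset.setIC ?AB0 finset.setIid cards0;
  rewrite ?addn0 ?min0n ?addn0 (minn_idPr (leq_pred _)) ?addn0.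
Qed.

(** The relaxation at work: on the empty left part [rank_pt] is 1, and the maximum with 2 supplies
    the one missing for full rank. *)
Lemma vamos_rank_full : vamos_rank (vamos_set set0 (A :|: B)) = #|A| + #|B|.
Proof.
rewrite /vamos_rank /= left_part_vamos_set right_part_vamos_set rank_set0.
rewrite (finset.setIidPr (finset.subsetUl A B)).
rewrite (finset.setIidPr (finset.subsetUr A B)).
by have := A_gt0; have := B_gt0; lia.
Qed.

Lemma vamos_rank_inr k : vamos_rank [set inr k] = (k \in A :|: B).
Proof.
have card1 (D : {set K}) : #|[set k]%SET :&: D| = (k \in D).
  have [kD|kD] := boolP (k \in D).
    by rewrite (finset.setIidPl _) ?cards1// finset.sub1set.
  apply/eqP; rewrite cards_eq0 -finset.subset0; apply/fintype.subsetP => k'.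
  by rewrite finset.in_setI finset.in_set1 => /andP[/eqP ->]; rewrite (negPf kD).
rewrite -[[set _]]set0U -(image_set0 inl) -vamos_set1.
rewrite /vamos_rank /= left_part_vamos_set right_part_vamos_set rank_set0 !card1.
have : ~~ ((k \in A) && (k \in B)).
  by rewrite -finset.in_setI AB0 finset.in_set0.
rewrite finset.in_setU; have := A_gt0; have := B_gt0.
by case: (k \in A); case: (k \in B) => //=; lia.
Qed.

Lemma vamos_rank1 x : vamos_rank [set x] <= 1.
Proof.
case: x => [t|k]; last by rewrite vamos_rank_inr leq_b1.
by rewrite -image_set1 vamos_rank_left; exact: rank_set1_le.
Qed.

Lemma vamos_rank_bounded X : vamos_rank X <= #|A| + #|B|.
Proof. by have [] := vamos_rank_le X. Qed.

Definition vamos : matroid (T + K) := matroid_of_rank vamos_ground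
  vamos_rank0 vamos_rank1 vamos_rank_mono vamos_rank_submod vamos_rank_bounded.

Lemma indep_vamos_left I : I `<=` ground M ->
  indep vamos (inl @` I) <-> indep M I.
Proof.
move=> IM; have inj (x y : T) : I x -> I y -> inl x = inl y :> T + K -> x = y.
  by move=> _ _ [].
split=> [[_ /(finite_preim_image inj) fI]|MI].
  rewrite size_set_image// vamos_rank_left => Is; apply: indep_rank => //.
  by have := rank_le_size M fI; lia.
have fI := indep_finite MI; split.
- by move=> _ [t /IM ? <-].
- exact: finite_image.
by rewrite size_set_image// vamos_rank_left rank_indep.
Qed.

(** The right-hand side does not depend on [A] and [B], so matroids built from different circuits
    agree on [M]. *)
Lemma indep_vamos_sub J : J `<=` inl @` ground M ->
  indep vamos J <-> indep M (left_part J).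
Proof.
move=> JM; have JE : J = inl @` left_part J.
  apply/seteqP; split=> [x Jx|x [t Jt <-]//].
  by have [t _ e] := JM x Jx; exists t => //; rewrite /left_part /= e.
rewrite {1}JE; apply: indep_vamos_left => t Jt.
by have [t2 Mt2 [<-]] := JM _ Jt.
Qed.

Lemma vamos_extension : extension inl M vamos.
Proof.
split; first by move=> _ [t Mt <-].
split.
  split=> [t Mt|x y _ _ []//|_ [_ [t Mt <-]]]; last by exists t.
  by split; [|exists t].
move=> I IM; split=> [MI|[/(indep_vamos_left IM)]] //.
by split; [apply/indep_vamos_left|apply: image_subset].
Qed.

Lemma vamos_loopless : loopless vamos.
Proof.
move=> x [gx]; apply; split; [by move=> _ ->|exact: finite_set1|].
rewrite size_set1; case: x gx => [t Mt|k kAB]; last by rewrite vamos_rank_inr kAB.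
have Ml := disjoint_flats_loopless (cut_flat cutC Cl) (cut_flat cutC CH) lH0.
by rewrite -image_set1 vamos_rank_left loopless_rank.
Qed.

Lemma rank_vamos_le X : rank vamos X <= vamos_rank X.
Proof. exact: rank_of_rank_le. Qed.

Lemma rank_vamos X : finite_set X -> X `<=` vamos_ground ->
  rank vamos X = vamos_rank X.
Proof. exact: rank_of_rank. Qed.

Lemma vamos_set_ground Y D : Y `<=` ground M -> D \subset A :|: B ->
  vamos_set Y D `<=` vamos_ground.
Proof.
by move=> YM /fintype.subsetP DAB _ [[t /YM Mt <-]|[k /DAB kAB <-]].
Qed.

Lemma finite_vamos_set Y D : finite_set Y -> finite_set (vamos_set Y D).
Proof.
by move=> fY; rewrite finite_setU; split; exact: finite_image.
Qed.

Lemma rank_vamos_part_le Y (D : {set K}) : D = A \/ D = B -> C Y ->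
  rank vamos (vamos_set Y D) <= maxn 2 (rank M Y) + #|D|.-1.
Proof.
move=> DAB CY; apply: leq_trans (rank_vamos_le _) _.
have [_ clY] := cut_flat cutC CY.
by rewrite vamos_rank_part// rank_pt_cut ?clY//; lia.
Qed.

(** [Y] may be infinite, where [vamos_rank] only bounds the rank from above, so a finite basis of
    [Y] is used. *)
Lemma rank_vamos_part_ge Y (D : {set K}) : D = A \/ D = B -> Y `<=` ground M ->
  minn (rank M Y + #|D|.-1) (#|A| + #|B|) <= rank vamos (vamos_set Y D).
Proof.
move=> DAB YM; have [I [MI IY e]] := rank_basis M Y.
apply: (@leq_trans (rank vamos (vamos_set I D))); last first.
  by apply: rank_mono => x [[t It <-]|Dx]; [left; exists t => //; exact: IY|right].
rewrite rank_vamos; first last.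
- apply: vamos_set_ground; first exact: indep_ground MI.
  by case: DAB => ->; [exact: finset.subsetUl|exact: finset.subsetUr].
- by apply: finite_vamos_set; exact: indep_finite MI.
rewrite vamos_rank_part//.
by have := rank_le_pt M C I; rewrite (rank_indep MI) e; lia.
Qed.

Lemma rank_vamos_circuits :
  #|A| + #|B| <= rank vamos (inr @` [set` A] `|` inr @` [set` B]).
Proof.
rewrite -vamos_rank_full -rank_vamos; first last.
- by apply: vamos_set_ground => //; exact: sub0set.
- by apply: finite_vamos_set; exact: finite_set0.
apply: rank_mono => _ [[t []]|[k /= + <-]].
by rewrite finset.in_setU => /orP[Ak|Bk]; [left|right]; exists k.
Qed.

(* A + p is the modular intersection of l + A + p and H + A + p. *)
Lemma rank_circuit_point (V : Type) (N : matroid V) (L G S : set V) p s h :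
  rank N (L `|` S) <= s.+1 -> rank N (G `|` S) < h + s ->
  h + s <= rank N ((L `|` G) `|` S) -> cl N L p -> cl N G p ->
  rank N (S `|` [set p]) <= s.
Proof.
move=> Ls Gs LGs Lp Gp.
have := rank_submod N (L `|` S `|` [set p]) (G `|` S `|` [set p]).
rewrite (rankU1_cl Lp (@subsetUl _ L S)) (rankU1_cl Gp (@subsetUl _ G S)).
have : rank N ((L `|` G) `|` S) <=
    rank N ((L `|` S `|` [set p]) `|` (G `|` S `|` [set p])).
  by apply: rank_mono => x [[Lx|Gx]|Sx];
    [left; left; left|right; left; left|left; left; right].
have : rank N (S `|` [set p]) <=
    rank N ((L `|` S `|` [set p]) `&` (G `|` S `|` [set p])).
  by apply: rank_mono => x [Sx|xp]; split; [left; right|left; right|right|right].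
lia.
Qed.

Lemma vamos_separates : rank M l = 2 -> 1 < rank M H ->
  rank M H <= #|A| -> rank M H <= #|B| ->
  forall (V : Type) (j : T + K -> V) (N : matroid V),
  extension j vamos N -> loopless N ->
  cl N (j @` (inl @` l)) `&` cl N (j @` (inl @` H)) = set0.
Proof.
move=> l2 H1 HA HB V j N jN Nl; rewrite -subset0 => p [lp Hp].
have [lM _] := cut_flat cutC Cl; have [HM clH] := cut_flat cutC CH.
have lHM : l `|` H `<=` ground M by move=> t [/lM|/HM].
have jrank Y D : Y `<=` ground M -> D \subset A :|: B ->
    rank N (j @` (inl @` Y) `|` j @` (inr @` [set` D])) = rank vamos (vamos_set Y D).
  by move=> YM DAB; rewrite -image_setU (extension_rank jN)//; exact: vamos_set_ground.
(* Otherwise [l] lies in [H], so it equals the empty intersection and has rank 0. *)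
have rlH : rank M H < rank M (l `|` H).
  rewrite ltnNge; apply/negP => le.
  have lsubH : l `<=` H.
    move=> t lt; rewrite -clH; apply: mem_cl; first exact: lM.
    by apply: leq_trans le; apply: rank_mono => y [Hy|->]; [right|left].
  move: l2; rewrite (_ : l = set0) ?rank_set0// -subset0 -lH0 => t lt.
  by split=> //; exact: lsubH.
have part (D : {set K}) : D = A \/ D = B ->
    rank N (j @` (inr @` [set` D]) `|` [set p]) <= #|D|.
  move=> DAB; have sD : D \subset A :|: B.
    by case: DAB => ->; [exact: finset.subsetUl|exact: finset.subsetUr].
  have D0 : 0 < #|D| by case: DAB => ->.
  apply: (rank_circuit_point (h := rank M H) _ _ _ lp Hp); rewrite -?image_setU.
  - rewrite image_setU jrank//; apply: leq_trans (rank_vamos_part_le DAB Cl) _.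
    by rewrite l2 maxnn; lia.
  - rewrite image_setU jrank//; apply: leq_ltn_trans (rank_vamos_part_le DAB CH) _.
    lia.
  (* As [rank M H] is at most the size of either circuit, the truncation leaves the required lower
     bound intact. *)
  rewrite image_setU jrank//; apply: leq_trans (rank_vamos_part_ge DAB lHM).
  by case: DAB => -> in D0 *; lia.
have pA := part A (or_introl erefl); have pB := part B (or_intror erefl).
have Np : ground N p by case: lp.
have p1 := loopless_rank Nl Np.
set jA := j @` (inr @` [set` A]) in pA; set jB := j @` (inr @` [set` B]) in pB.
have := rank_submod N (jA `|` [set p]) (jB `|` [set p]).
have : rank N [set p] <= rank N ((jA `|` [set p]) `&` (jB `|` [set p])).
  by apply: rank_mono => _ ->; split; right.
have : rank vamos (inr @` [set` A] `|` inr @` [set` B]) <=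
    rank N ((jA `|` [set p]) `|` (jB `|` [set p])).
  rewrite -(extension_rank jN).
    rewrite image_setU; apply: rank_mono => x [Ax|Bx]; [left; left|right; left]; done.
  by move=> _ [[k /= kA <-]|[k /= kB <-]]; rewrite /= finset.in_setU ?kA ?kB ?orbT.
have := rank_vamos_circuits; lia.
Qed.

(** With [A] a singleton, the circuit [A] + p makes [k] parallel to p, so [k] realizes the virtual
    point. *)
Lemma vamos_cl Y k : A = [set k]%SET -> C Y -> 1 < rank M Y ->
  cl vamos (inl @` Y) (inr k).
Proof.
move=> Ak CY Y1; have [YM _] := cut_flat cutC CY.
apply: mem_cl; first by rewrite /= Ak finset.in_setU finset.set11.
rewrite -vamos_set1 -Ak; apply: leq_trans (rank_vamos_part_le (or_introl erefl) CY) _.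
rewrite (extension_rank vamos_extension YM) Ak cards1; lia.
Qed.

End Vamos.

(** * Points of extensions, and amalgams *)

Lemma extension_cl (T U : Type) (i : T -> U) (M : matroid T) (N : matroid U)
    (X : set T) x :
  extension i M N -> X `<=` ground M -> cl M X x -> cl N (i @` X) (i x).
Proof.
move=> iN XM [Mx Xx]; split; first by apply: iN.1; exists x.
rewrite -image_set1 -image_setU !(extension_rank iN)//.
by move=> y [/XM|->].
Qed.

(** Submodularity in [N] for [X] + p and [Y] + p: neither rank is raised by p, so for a modular pair
    the intersection does not gain rank from p either. *)
Lemma point_modular_cut (T V : Type) (j : T -> V) (M : matroid T)
    (N : matroid V) p :
  extension j M N -> modular_cut M [set F | flat M F /\ cl N (j @` F) p].
Proof.
move=> jN; split=> [F []//|X F [fX Xp] fF XF|X Y [fX Xp] [fY Yp] mXY].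
  by split=> //; apply: cl_mono Xp; exact: image_subset.
have [XM _] := fX; have [YM _] := fY.
have fXY := flatI fX fY; have [XYM _] := fXY; split=> //.
have UM : X `|` Y `<=` ground M by move=> x [/XM|/YM].
apply: mem_cl; first by case: Xp.
have := rank_submod N (j @` X `|` [set p]) (j @` Y `|` [set p]).
rewrite (rankU1_cl Xp (@subset_refl _ _)) (rankU1_cl Yp (@subset_refl _ _)).
rewrite !(extension_rank jN)// mXY -(extension_rank jN UM) image_setU.
have : rank N (j @` X `|` j @` Y) <=
    rank N (j @` X `|` [set p] `|` (j @` Y `|` [set p])).
  by apply: rank_mono => x [Xx|Yx]; [left; left|right; left].
have : rank N (j @` (X `&` Y) `|` [set p]) <=
    rank N ((j @` X `|` [set p]) `&` (j @` Y `|` [set p])).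
  apply: rank_mono => x [[y [Xy Yy] <-]|xp]; last by split; right.
  by split; left; exists y.
lia.
Qed.

Lemma restrict_extension (T : Type) (M N : matroid T) :
  ground M `<=` ground N -> Defs.restrict N (ground M) = M -> extension id M N.
Proof.
move=> MN NM; split; first by rewrite image_id.
rewrite image_id NM; split; last by move=> I _; rewrite image_id.
by split=> [x|x y _ _|x Mx] //; exists x.
Qed.

Lemma amalgam_loopless (T : Type) (N1 N2 A : matroid T) :
  amalgam N1 N2 A -> loopless N1 -> loopless N2 -> loopless A.
Proof.
have sub (N : matroid T) : Defs.restrict A (ground N) = N ->
    forall I, indep N I -> indep A I by move=> <- I [].
move=> [gA /sub s1 /sub s2] N1l N2l x [Ax nx].
move: Ax; rewrite gA => -[g1|g2].
  by apply: (N1l x); split=> // /s1.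
by apply: (N2l x); split=> // /s2.
Qed.

Lemma extension_refl (T : Type) (M : matroid T) : extension id M M.
Proof.
apply: restrict_extension => //; apply: matroid_eqP => /=; first exact: setIid.
by apply/seteqP; split=> [I []//|I MI]; split=> //; exact: indep_ground MI.
Qed.

(** * Disjoint sets of r points, and the theorem *)

Definition row_set m n (c : 'I_m) : {set 'I_m * 'I_n} :=
  finset.setX [set c]%SET [set: 'I_n]%SET.

Lemma card_row_set m n (c : 'I_m) : #|row_set n c| = n.
Proof. by rewrite finset.cardsX cards1 cardsT card_ord mul1n. Qed.

Lemma row_setI m n (c d : 'I_m) : c != d -> row_set n c :&: row_set n d = finset.set0.
Proof.
move=> cd; apply/setP => -[e i]; rewrite finset.in_setI !finset.in_setX.
rewrite !finset.in_set1 !finset.in_setT !andbT finset.in_set0.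
by apply/negP => /andP[/eqP -> ]; rewrite (negPf cd).
Qed.

Theorem theorem3p2 (r : nat) (hr : 4 <= r) (T : Type) (M : matroid T)
    (hM : mrank M = r) (l H : set T) (hl : line M l) (hH : hyperplane M H)
    (hlH : l `&` H = set0) :
  (exists (U : Type) (i : T -> U) (N : matroid U),
     [/\ extension i M N, loopless N
       & forall (V : Type) (j : U -> V) (N' : matroid V),
           extension j N N' -> loopless N' ->
           cl N' ((j \o i) @` l) `&` cl N' ((j \o i) @` H) = set0]) /\
  (intersection_property M -> ~ sticky M).
Proof.
have [fl l2] := hl; have [fH rH] := hH; rewrite hM in rH.
have [r0 [H1 Hr]] : 0 < r /\ 1 < rank M H /\ rank M H <= r by lia.
have ne (a b : nat) : a < 4 -> b < 4 -> a != b -> inord a != inord b :> 'I_4.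
  by move=> a4 b4; rewrite -val_eqE /= !inordK.
(* Rows 0 and 1 of a 4 by r grid are the circuits of the first matroid; rows 2 and 3 are kept for
   the second, on the same carrier. *)
pose A : {set 'I_4 * 'I_r} := row_set r (inord 0).
pose B : {set 'I_4 * 'I_r} := row_set r (inord 1).
have A0 : 0 < #|A| by rewrite card_row_set.
have B0 : 0 < #|B| by rewrite card_row_set.
have AB0 : A :&: B = finset.set0 by rewrite row_setI// ne.
have AB : mrank M <= #|A| + #|B| by rewrite !card_row_set hM leq_addr.
have HA : rank M H <= #|A| by rewrite card_row_set.
have HB : rank M H <= #|B| by rewrite card_row_set.
split.
  have [[C [cutC Cl CH C0]]|noC] := pselect (exists C,
      [/\ modular_cut M C, C l, C H & ~ C set0]).
    pose N := vamos cutC Cl CH C0 hlH AB0 A0 B0 AB.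
    exists (T + 'I_4 * 'I_r)%type, inl, N; split.
    - exact: vamos_extension.
    - exact: vamos_loopless.
    move=> V j N' jN N'l; rewrite -(image_comp inl j l) -(image_comp inl j H).
    exact: vamos_separates jN N'l.
  exists T, id, M; split; first exact: extension_refl.
    exact: disjoint_flats_loopless fl fH hlH.
  move=> V j N jN Nl; rewrite -subset0 => p [lp Hp]; apply: noC.
  exists [set F | flat M F /\ cl N (j @` F) p]; split=> //.
    exact: point_modular_cut.
  (* The closure of the empty set consists of loops, and [N] has none. *)
  move=> [_]; rewrite image_set0 => -[Np]; rewrite rank_set0 set0U.
  by rewrite loopless_rank.
move=> IP stickyM.
(* The ranks 2 and r - 1 add up to r + 1, more than the rank of any union. *)
have nonmod : ~ modular_pair M l H.
  rewrite /modular_pair hlH rank_set0 l2.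
  have : rank M (l `|` H) <= mrank M.
    by rewrite -rank_ground rank_mono//; exact: subIsetr.
  by rewrite hM; lia.
have [C [cutC Cl CH]] := IP _ _ fl fH nonmod; rewrite hlH => C0.
(* The singleton [P] realizes the virtual point, and [Q] makes the truncation rank at least r. *)
pose p : 'I_4 * 'I_r := (inord 2, Ordinal r0).
pose P : {set 'I_4 * 'I_r} := [set p]%SET.
pose Q : {set 'I_4 * 'I_r} := row_set r (inord 3).
have P0 : 0 < #|P| by rewrite cards1.
have Q0 : 0 < #|Q| by rewrite card_row_set.
have PQ0 : P :&: Q = finset.set0.
  apply/eqP; rewrite -finset.subset0 -(row_setI r (ne 2 3 isT isT isT)).
  by rewrite finset.setSI// finset.sub1set finset.in_setX finset.set11 finset.in_setT.
have PQ : mrank M <= #|P| + #|Q| by rewrite card_row_set hM leq_addl.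
pose N1 := vamos cutC Cl CH C0 hlH AB0 A0 B0 AB.
pose N2 := vamos cutC Cl CH C0 hlH PQ0 P0 Q0 PQ.
have g12 : ground N1 `&` ground N2 = inl @` ground M.
  apply/seteqP; split=> [[t|[d i]] /= []|_ [t Mt <-]] //; first by exists t.
  rewrite !finset.in_setU !finset.in_setX !finset.in_set1 !finset.in_setT !andbT.
  rewrite xpair_eqE => AB01 PQ23; have : (d == inord 2) || (d == inord 3).
    by case/orP: PQ23 => [/andP[-> //]|->]; rewrite orbT.
  by case/orP: AB01 => /eqP -> /orP[]; rewrite (negPf (ne _ _ _ _ _)).
have e1 : extension inl M N1 by exact: vamos_extension.
have e2 : extension inl M N2 by exact: vamos_extension.
have r12 : Defs.restrict N1 (inl @` ground M) = Defs.restrict N2 (inl @` ground M).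
  apply: matroid_eqP => /=; first by rewrite !setIidr//; case: e1 e2 => + _ [].
  have i1 J := @indep_vamos_sub _ _ _ _ _ cutC Cl CH C0 hlH _ _ _ AB0 A0 B0 AB J.
  have i2 J := @indep_vamos_sub _ _ _ _ _ cutC Cl CH C0 hlH _ _ _ PQ0 P0 Q0 PQ J.
  apply/seteqP; split=> J [NJ JM]; split=> //.
    exact/(i2 J JM)/(i1 J JM).
  exact/(i1 J JM)/(i2 J JM).
have [||D AD] := stickyM _ N1 N2; rewrite ?g12//.
  by exists inl; exact: e1.2.
have [gD D1 D2] := AD.
have d1 : extension id N1 D.
  by apply: restrict_extension D1; rewrite gD; exact: subsetUl.
have d2 : extension id N2 D.
  by apply: restrict_extension D2; rewrite gD; exact: subsetUr.
have Dl : loopless D by apply: amalgam_loopless AD _ _; exact: vamos_loopless.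
(* The amalgam extends [N1], which keeps the two closures disjoint, and [N2], which puts [inr p] in
   both. *)
have : set0 (inr p : T + 'I_4 * 'I_r)%type.
  rewrite -(vamos_separates l2 H1 HA HB d1 Dl).
  have pcl F : C F -> 1 < rank M F -> cl D (id @` (inl @` F)) (inr p).
    move=> CF F1; have [FM _] := cut_flat cutC CF.
    apply: (extension_cl d2); last exact: vamos_cl.
    by move=> _ [t /FM Mt <-].
  by split; apply: pcl => //; rewrite l2.
by [].
Qed.
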